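(* Let $n=ks$ with $s\geq2$ and let $\mathbf{T}$ be a subgroup of order $t$ of $\langle\psi(M_s)\rangle$ such that $\gcd(t,q^k-1)=\gcd(t,q-1)$. For $m\geq2$, let $\{\mathcal{F}^j\}_{j=1}^m$ be flags on $\mathbb{F}_q^n$ of type $(1,\dots,k,n-k,\dots,n-1)$ such that the $k$-dimensional subspaces $\mathcal{F}^1_k,\dots,\mathcal{F}^m_k$ belong to $\mathcal{S}$ and lie in pairwise different $\mathbf{T}$-orbits, and the $(n-k)$-dimensional subspaces $\mathcal{F}^1_{n-k},\dots,\mathcal{F}^m_{n-k}$ belong to $\mathcal{H}$ and lie in pairwise different $\mathbf{T}$-orbits. Then: (i) $\bigcup_{j=1}^m\mathrm{Orb}_{\mathbf{T}}(\mathcal{F}^j)$ is an optimum distance flag code of size $\frac{mt}{\gcd(t,q-1)}$; (ii) if $m=\frac{(q^n-1)\gcd(t,q-1)}{(q^k-1)t}$, then $\bigcup_{j=1}^m\mathrm{Orb}_{\mathbf{T}}(\mathcal{F}^j)$ is an optimum distance flag code of size $\frac{q^n-1}{q^k-1}$ (the maximum size).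
   Context: Let $\omega$ be a primitive element of $\mathbb{F}_{q^k}$, with minimal polynomial over $\mathbb{F}_q$ having companion matrix $M_k\in\mathrm{GL}(k,q)$; $\phi:\mathbb{F}_{q^k}=\mathbb{F}_q[\omega]\to\mathbb{F}_q[M_k]$, $\sum_i a_i\omega^i\mapsto\sum_i a_iM_k^i$ is a field isomorphism. For a matrix $A=(a_{ij})$ over $\mathbb{F}_{q^k}$, $\psi(A)$ is the block matrix $(\phi(a_{ij}))$ over $\mathbb{F}_q$, and for an $\mathbb{F}_{q^k}$-subspace $\mathrm{rowsp}(A)$ of $\mathbb{F}_{q^k}^s$, $\varphi(\mathrm{rowsp}(A))=\mathrm{rowsp}(\psi\text{-style block matrix }(\phi(a_{ij})))\subseteq\mathbb{F}_q^{ks}$. Let $\alpha$ be a primitive element of $\mathbb{F}_{q^n}$ and $M_s\in\mathrm{GL}(s,q^k)$ the companion matrix of the minimal polynomial of $\alpha$ over $\mathbb{F}_{q^k}$; $\langle\psi(M_s)\rangle\leq\mathrm{GL}(n,q)$ is cyclic of order $q^n-1$. $\mathcal{S}=\{\varphi(l)\mid l\text{ 1-dim subspace of }\mathbb{F}_{q^k}^s\}$ and $\mathcal{H}=\{\varphi(h)\mid h\text{ }(s-1)\text{-dim subspace of }\mathbb{F}_{q^k}^s\}$. A flag of type $(1,\dots,k,n-k,\dots,n-1)$ is a chain of subspaces of $\mathbb{F}_q^n$ with these dimensions (with $k=n-k$ listed once if $s=2$); $\mathcal{F}_d$ denotes its $d$-dimensional member. $\mathrm{GL}(n,q)$ acts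 on subspaces by $\mathcal{V}\cdot A=\mathrm{rowsp}(VA)$ and on flags componentwise. With $d_S(\mathcal{U},\mathcal{V})=\dim(\mathcal{U}+\mathcal{V})-\dim(\mathcal{U}\cap\mathcal{V})$ and $d_f(\mathcal{F},\mathcal{F}')=\sum_i d_S(\mathcal{F}_i,\mathcal{F}'_i)$, a flag code of type $(t_1,\dots,t_r)$ is an optimum distance flag code if its minimum flag distance ($0$ if it has one element) equals $2\left(\sum_{2t_i\leq n}t_i+\sum_{2t_i>n}(n-t_i)\right)$. *)

(* Defs.v *)
From HB Require Import structures.
From mathcomp Require Import all_boot all_order all_algebra all_fingroup.
From mathcomp Require Import all_field finmap.

Set Implicit Arguments.
Unset Strict Implicit.
Unset Printing Implicit Defensive.

Import GRing.Theory.
Local Open Scope ring_scope.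

(* Companion matrix of a monic polynomial of degree d.  companionmx p has size
   (size p).-1, which is only propositionally equal to d = deg p; conform_mx
   retypes it and would only fall back to 0 if the degree were not d. *)
Definition companion (R : nzRingType) (d : nat) (p : {poly R}) : 'M[R]_d :=
  conform_mx 0 (companionmx p).

Section Subspaces.

Variables (R : fieldType) (n : nat).
Implicit Types U V : {vspace 'rV[R]_n}.

Definition rowsp (m : nat) (A : 'M[R]_(m, n)) : {vspace 'rV[R]_n} :=
  <<[seq row i A | i : 'I_m]>>%VS.

Definition vsmx U : 'M[R]_(\dim U, n) := \matrix_i (vbasis U)`_i.

Lemma rowsp_vsmx U : rowsp (vsmx U) = U.
Proof.
rewrite -[RHS](span_basis (vbasisP U)) /rowsp; apply: eq_span => v.
apply/imageP/(tnthP (vbasis U)) => [[i _ ->]|[i ->]]; exists i => //;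
  by rewrite rowK (tnth_nth 0).
Qed.

Definition subspace_dist U V : nat := \dim (U + V) - \dim (U :&: V).

(* A flag is the list of its subspaces in increasing order; its type is the
   list ty of their dimensions. *)
Definition is_flag (ty : seq nat) (f : seq {vspace 'rV[R]_n}) : bool :=
  ([seq \dim U | U <- f] == ty) && sorted (fun U V => U <= V)%VS f.

(* The d-dimensional member of a flag of type ty, for d \in ty. *)
Definition flag_member (ty : seq nat) (f : seq {vspace 'rV[R]_n}) (d : nat) :
  {vspace 'rV[R]_n} := nth 0%VS f (index d ty).

Definition flag_dist (f g : seq {vspace 'rV[R]_n}) : nat :=
  \sum_(UV <- zip f g) subspace_dist UV.1 UV.2.

Local Open Scope fset_scope.

Definition is_flag_code (ty : seq nat) (C : {fset seq {vspace 'rV[R]_n}}) :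
  Prop := forall f, f \in C -> is_flag ty f.

(* 0 if C has at most one element. *)
Definition min_flag_dist (C : {fset seq {vspace 'rV[R]_n}}) : nat :=
  let ds := [seq flag_dist fg.1 fg.2
            | fg <- [seq (f, g) | f <- C, g <- C] & fg.1 != fg.2] in
  \big[minn/head 0%N ds]_(d <- ds) d.

Definition optimum_distance (ty : seq nat)
  (C : {fset seq {vspace 'rV[R]_n}}) : Prop :=
  is_flag_code ty C /\
  min_flag_dist C =
    (2 * (\sum_(d <- ty | 2 * d <= n) d + \sum_(d <- ty | n < 2 * d) (n - d)))%N.

End Subspaces.

(* (1, ..., k, n - k, ..., n - 1), with k = n - k listed once if n = 2 k. *)
Definition ftype (n k : nat) : seq nat := undup (iota 1 k ++ iota (n - k) k).

Section Actions.

Variables (F : finFieldType) (n : nat).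

(* The ambient dimension is n.+1 because 'GL_d[F] consists of matrices of size
   d.-1.+1, which is convertible to d only if d is a successor. *)
Definition vsact (U : {vspace 'rV[F]_n.+1}) (A : {'GL_n.+1[F]}) :
  {vspace 'rV[F]_n.+1} := rowsp (vsmx U *m (GLval A : 'M[F]_n.+1)).

Definition flagact (f : seq {vspace 'rV[F]_n.+1}) (A : {'GL_n.+1[F]}) :
  seq {vspace 'rV[F]_n.+1} := [seq vsact U A | U <- f].

Definition orb (X : choiceType) (act : X -> {'GL_n.+1[F]} -> X)
  (T : {group {'GL_n.+1[F]}}) (x : X) : {fset X} :=
  [fset act x A | A in T]%fset.

End Actions.

Section FieldReduction.

Variables (F : fieldType) (K : fieldExtType F) (k : nat).

(* phi : K = F[omega] -> F[M], sum_i a_i omega^i |-> sum_i a_i M^i, the a_i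
   being the coordinates in the basis (omega^i)_(i < k) of K over F. *)
Definition phi (omega : K) (M : 'M[F]_k) (x : K) : 'M[F]_k :=
  \sum_(i < k) coord [tuple omega ^+ j | j < k] i x *: M ^+ i.

Definition phimx (omega : K) (M : 'M[F]_k) (a b : nat) (A : 'M[K]_(a, b)) :
  'M[F]_(\sum_(i < a) k, \sum_(j < b) k) :=
  \mxblock_(i < a, j < b) phi omega M (A i j).

Lemma blocks_size (n s : nat) : n = (k * s)%N -> (\sum_(j < s) k)%N = n.
Proof. by move=> ->; rewrite sum_nat_const card_ord mulnC. Qed.

Variables (n s : nat) (hn : n = (k * s)%N) (omega : K) (M : 'M[F]_k).

Definition psi (A : 'M[K]_s) : 'M[F]_n :=
  castmx (blocks_size hn, blocks_size hn) (phimx omega M A).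

(* When omega generates K over F and M is the companion matrix of its minimal
   polynomial, phi is a ring morphism and the result does not depend on the
   choice of the matrix vsmx U with row space U. *)
Definition varphi (U : {vspace 'rV[K]_s}) : {vspace 'rV[F]_n} :=
  rowsp (castmx (erefl, blocks_size hn) (phimx omega M (vsmx U))).

Definition reduced (d : nat) (V : {vspace 'rV[F]_n}) : Prop :=
  exists2 U : {vspace 'rV[K]_s}, \dim U = d & V = varphi U.

Definition Slines : {vspace 'rV[F]_n} -> Prop := reduced 1.
Definition Hhyperplanes : {vspace 'rV[F]_n} -> Prop := reduced s.-1.

End FieldReduction.

(* Main.v *)
Require Import Defs.
From HB Require Import structures.
From mathcomp Require Import all_boot all_order all_algebra all_fingroup.
From mathcomp Require Import all_solvable all_field finmap zify.

Set Implicit Arguments.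
Unset Strict Implicit.
Unset Printing Implicit Defensive.

Import GRing.Theory.
Local Open Scope ring_scope.

(* Concatenating coordinates gives an F_q-linear bijection rho from F_(q^k)^s to
   F_q^n with rho (v B) = rho v psi(B) under which varphi(U) is the image of U.
   Hence distinct members of S meet trivially and distinct members of H span
   F_q^n; since the other members of the flags are nested inside (resp. around)
   them, this forces every distance between distinct flags to be maximal.

   If a power B of M_s stabilises a line or a hyperplane over F_(q^k), it has an
   eigenvalue c in F_(q^k); as F_(q^k)[M_s] is a field, B = c.  Elements of T
   stabilising a member of S or H therefore satisfy A^(q^k-1) = 1, hence
   A^(q-1) = 1 by the gcd hypothesis, and are scalars over F_q, which fix every
   subspace.  So all the stabilisers coincide with the group of the gcd(t, q-1)
   elements of T of order dividing q - 1, which gives the size of the code.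

   Conversely, the k-dimensional members of an optimum distance flag code form a
   partial spread, whence the bound (q^n - 1) / (q^k - 1). *)

(** * Companion matrices of minimal polynomials *)

Lemma char_poly_companion (R : comNzRingType) d (p : {poly R}) :
  p \is monic -> size p = d.+1 -> char_poly (companion d p) = p.
Proof.
move=> mon_p sz_p; have sz_d : (size p).-1 = d by rewrite sz_p.
rewrite -[RHS](companionmxK mon_p) /companion.
(* Eliminating the degree equation makes both matrix sizes syntactically equal, so [conform_mx] is
   the identity. *)
by case: d / sz_d {sz_p}; rewrite conform_mx_id.
Qed.

Section CompanionOfMinPoly.

Variables (F : fieldType) (L : fieldExtType F) (x : L) (d : nat).
Variables (p : {poly F}) (M : 'M[F]_d.+1).
Hypothesis p_min : map_poly (in_alg L) p = minPoly 1 x.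
Hypothesis deg_x : adjoin_degree 1 x = d.+1.
Hypothesis M_comp : M = companion d.+1 p.

Lemma horner_companion_minPoly : horner_mx M p = 0.
Proof.
have mon_p : p \is monic by rewrite -(map_monic (in_alg L)) p_min monic_minPoly.
have sz_p : size p = d.+2.
  by rewrite -(size_map_poly (in_alg L)) p_min size_minPoly deg_x.
rewrite M_comp -[X in horner_mx _ X](char_poly_companion mon_p sz_p).
exact: Cayley_Hamilton.
Qed.

Lemma horner_companion_root r : root (map_poly (in_alg L) r) x ->
  horner_mx M r = 0.
Proof.
move=> /(minPoly_dvdp (alg_polyOver 1 r)); rewrite -p_min dvdp_map.
by case/dvdpP=> u ->; rewrite rmorphM /= horner_companion_minPoly mulr0.
Qed.

(** The minimal polynomial is irreducible, so [r] is coprime to [p], and evaluating a Bezout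
    relation at [M] kills the term in [p] and leaves an inverse of [r] at [M]. *)
Lemma horner_companion_unit r : ~~ root (map_poly (in_alg L) r) x ->
  horner_mx M r \in unitmx.
Proof.
move=> nz_r.
have [] := orP (minPoly_irr (alg_polyOver 1 (gcdp r p))
  (_ : _ %| minPoly 1 x)).
- by rewrite -p_min dvdp_map dvdp_gcdr.
- rewrite -p_min eqp_map => /andP[_]; rewrite dvdp_gcd => /andP[p_r _].
  case/negP: nz_r; rewrite -dvdp_XsubCl.
  rewrite (dvdp_trans _ (_ : minPoly 1 x %| _)) //.
    by rewrite dvdp_XsubCl root_minPoly.
  by rewrite -p_min dvdp_map.
rewrite -(rmorph1 (map_poly (in_alg L))) eqp_map -size_poly_eq1.
case/Bezout_coprimepP=> [[u v] /= uv1].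
(* The combination [c] is only associate to 1; it is normalised by its leading coefficient. *)
set c := u * r + v * p in uv1.
have nz_c : lead_coef c != 0.
  by rewrite lead_coef_eq0 -size_poly_eq0 (eqp_size uv1) size_poly1.
move/eqp_eq/(congr1 (horner_mx M)): uv1.
rewrite lead_coef1 scale1r {1}/c rmorphD !rmorphM /= horner_companion_minPoly.
rewrite mulr0 addr0 linearZ rmorph1 /= => uvM.
have [] // := @mulmx1_unit _ _ ((lead_coef c)^-1 *: horner_mx M u)
  (horner_mx M r).
by rewrite -scalemxAl [_ *m _]uvM scalerA mulVf // scale1r.
Qed.

End CompanionOfMinPoly.
(** A count: 0 and the powers of [x] give [Q ^ d] distinct elements of K(x), each a polynomial in
    [x] of degree below [adjoin_degree 1 x]. The list [e] makes the finiteness of K available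
    without a finite type structure on K. *)
Lemma adjoin_degree_primitive (K : fieldType) (L : fieldExtType K) (e : seq K)
    (x : L) : uniq e -> (forall c, c \in e) ->
  (size e ^ \dim {:L} - 1).-primitive_root x -> adjoin_degree 1 x = \dim {:L}.
Proof.
move=> uniq_e e_full prim_x; set d := \dim {:L} in prim_x *.
set Q := size e in prim_x.
have Q_gt1 : (1 < Q)%N.
  rewrite -[2%N]/(size [:: 0 : K; 1]); apply: uniq_leq_size => //=.
  by rewrite inE eq_sym oner_eq0.
apply/eqP; rewrite eqn_leq; apply/andP; split.
  by rewrite adjoin_degreeE dimv1 divn1 dimvS // subvf.
rewrite -(leq_exp2l _ _ Q_gt1).
have -> : (Q ^ d)%N = size (0 :: [seq x ^+ i | i <- iota 0 (Q ^ d - 1)]).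
  by rewrite /= size_map size_iota subn1 prednK // expn_gt0 ltnW.
have nz_x : x != 0.
  have /eqP := prim_expr_order prim_x; apply: contraTneq => ->.
  by rewrite expr0n gtn_eqF ?(prim_order_gt0 prim_x) // eq_sym oner_neq0.
(* [E] lists the values at [x] of these polynomials, one entry per choice of coefficients in [e]. *)
pose E := [seq \sum_(j < adjoin_degree 1 x) (ssval (f j))%:A * x ^+ j
           | f : {ffun 'I_(adjoin_degree 1 x) -> seq_sub e}].
have -> : (Q ^ adjoin_degree 1 x = size E)%N.
  by rewrite size_map -cardE card_ffun card_ord card_seq_sub.
apply: uniq_leq_size => [|y]; last first.
  move=> y_in; have y_x : y \in <<1; x>>%VS.
    move: y_in; rewrite inE => /orP[/eqP->|/mapP[i _ ->]]; first exact: mem0v.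
    by rewrite rpredX // memv_adjoin.
  rewrite -(Fadjoin_poly_eq y_x).
  have /polyOver1P[r def_r] := Fadjoin_polyOver 1 x y.
  have sz_r : (size r <= adjoin_degree 1 x)%N.
    by rewrite -(size_map_poly (in_alg L)) -def_r size_Fadjoin_poly.
  apply/mapP; exists [ffun j : 'I__ => SeqSub (e_full r`_j)].
    by rewrite mem_enum.
  rewrite def_r (horner_coef_wide (n := adjoin_degree 1 x)) ?size_map_poly //.
  by apply: eq_bigr => j _; rewrite ffunE coef_map.
rewrite /= map_inj_in_uniq ?iota_uniq ?andbT; last first.
  move=> i j; rewrite !mem_iota /= add0n => lti ltj.
  by move/eqP; rewrite (eq_prim_root_expr prim_x) !modn_small // => /eqP.
by apply/mapP=> [[i _ /esym/eqP]]; rewrite expf_eq0 (negPf nz_x) andbF.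
Qed.

(** * Field reduction *)

Section FieldReductionMap.

Variables (F : fieldType) (K : fieldExtType F) (omega : K) (d : nat).
Variables (p : {poly F}) (M : 'M[F]_d.+1).
Hypothesis p_min : map_poly (in_alg K) p = minPoly 1 omega.
Hypothesis dimK : \dim {:K} = d.+1.
Hypothesis deg_omega : adjoin_degree 1 omega = d.+1.
Hypothesis M_comp : M = companion d.+1 p.

Local Notation phi := (phi omega M).

Lemma horner_small (r : {poly F}) : (size r <= d.+1)%N ->
  (map_poly (in_alg K) r).[omega] = \sum_(i < d.+1) r`_i *: omega ^+ i.
Proof.
move=> sz_r; rewrite (horner_coef_wide (n := d.+1)) ?size_map_poly //.
by apply: eq_bigr => i _; rewrite coef_map /= mulr_algl.
Qed.

Lemma free_powers : free [tuple omega ^+ j | j < d.+1].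
Proof.
apply/freeP=> c c0 i.
have sz_r : (size (\poly_(j < d.+1) c (inord j)) <= d.+1)%N by exact: size_poly.
have : root (map_poly (in_alg K) (\poly_(j < d.+1) c (inord j))) omega.
  rewrite rootE horner_small // -[X in _ == X]c0; apply/eqP/eq_bigr => j _.
  by rewrite coef_poly ltn_ord inord_val -tnth_nth tnth_mktuple.
rewrite (root_small_adjoin_poly (alg_polyOver 1 _)); last first.
  by rewrite size_map_poly deg_omega.
rewrite map_poly_eq0 => /eqP/(congr1 (fun r : {poly F} => r`_i)).
by rewrite coef0 coef_poly ltn_ord inord_val.
Qed.

Lemma mem_alg_horner (x : K) : exists r, x = (map_poly (in_alg K) r).[omega].
Proof.
have : x \in <<1; omega>>%VS.
  suff -> : <<1; omega>>%VS = fullv :> {vspace K} by rewrite memvf.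
  apply/eqP; rewrite eqEdim subvf dimK -deg_omega.
  by rewrite adjoin_degreeE dimv1 divn1 leqnn.
case/Fadjoin_polyP=> r /polyOver1P[r' ->] ->; by exists r'.
Qed.

(** Both sides depend only on [r] modulo [p], and the coordinates of the value of a remainder are
    its coefficients. Every element of K is such a value, so [phi] inherits the ring laws of
    [horner_mx M]. *)
Lemma phi_horner r : phi (map_poly (in_alg K) r).[omega] = horner_mx M r.
Proof.
have p0 : p != 0.
  rewrite -(map_poly_eq0 (in_alg K)) p_min.
  by rewrite monic_neq0 // monic_minPoly.
have szp : size p = d.+2.
  by rewrite -(size_map_poly (in_alg K)) p_min size_minPoly deg_omega.
have [u [v [-> sz_v]]] : exists u v, r = u * p + v /\ (size v <= d.+1)%N.
  exists (r %/ p), (r %% p); split; first exact: divp_eq.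
  by rewrite -ltnS -szp ltn_modp.
rewrite !rmorphD !rmorphM /= hornerD hornerM p_min minPolyxx.
rewrite (horner_companion_minPoly p_min) // !mulr0 !add0r.
rewrite horner_small // /Defs.phi /horner_mx /= /horner_morph.
rewrite (horner_coef_wide (n := d.+1)) ?(leq_trans (size_poly _ _)) //.
apply: eq_bigr => i _.
have -> : \sum_(j < d.+1) v`_j *: omega ^+ j
  = \sum_(j < d.+1) v`_j *: [tuple omega ^+ j | j < d.+1]`_j.
  by apply: eq_bigr => j _; rewrite -tnth_nth tnth_mktuple.
rewrite coord_sum_free ?free_powers //.
by rewrite coef_map -mul_scalar_mx.
Qed.

Lemma phiB x y : phi (x - y) = phi x - phi y.
Proof.
have [[r ->] [r' ->]] := (mem_alg_horner x, mem_alg_horner y).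
by rewrite -hornerN -hornerD -rmorphB [in LHS]phi_horner rmorphB !phi_horner.
Qed.

Lemma phiM x y : phi (x * y) = phi x *m phi y.
Proof.
have [[r ->] [r' ->]] := (mem_alg_horner x, mem_alg_horner y).
by rewrite -hornerM -rmorphM [in LHS]phi_horner rmorphM !phi_horner.
Qed.

Lemma phi_alg a : phi a%:A = a%:M.
Proof.
have -> : a%:A = (map_poly (in_alg K) a%:P).[omega].
  by rewrite map_polyC hornerC.
by rewrite phi_horner horner_mx_C.
Qed.

Lemma phi_unit x : x != 0 -> phi x \in unitmx.
Proof.
have [r ->] := mem_alg_horner x.
by rewrite phi_horner; apply: (horner_companion_unit p_min).
Qed.

End FieldReductionMap.
Lemma mem_rowspP (F : fieldType) n m (A : 'M[F]_(m, n)) (w : 'rV[F]_n) :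
  reflect (exists c : 'rV_m, w = c *m A) (w \in rowsp A).
Proof.
pose X := [tuple row i A | i < m].
have -> : rowsp A = <<X>>%VS.
  by congr (<<_>>)%VS; rewrite /X /= /image_mem enumT.
apply: (iffP idP) => [/coord_span ->|[c ->]].
  exists (\row_i coord X i w); rewrite mulmx_sum_row; apply: eq_bigr => i _.
  by rewrite mxE -tnth_nth tnth_mktuple.
rewrite mulmx_sum_row memv_suml // => i _; rewrite memvZ //.
by apply: memv_span; apply/tnthP; exists i; rewrite tnth_mktuple.
Qed.

Lemma mem_vsact (F : finFieldType) (n : nat) (U : {vspace 'rV[F]_n.+1})
    (A : {'GL_n.+1[F]}) w :
  (w *m (GLval A : 'M_n.+1) \in vsact U A) = (w \in U).
Proof.
have uA : (GLval A : 'M_n.+1) \in unitmx := GL_unit A.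
rewrite -[in RHS](rowsp_vsmx U).
apply/mem_rowspP/mem_rowspP => -[c wc]; exists c; last by rewrite mulmxA wc.
by apply: (can_inj (mulmxK uA)); rewrite wc mulmxA.
Qed.

Lemma vsact_scalar (F : finFieldType) (n : nat) (U : {vspace 'rV[F]_n.+1})
    (A : {'GL_n.+1[F]}) a :
  GLval A = a%:M -> vsact U A = U.
Proof.
move=> A_a; have nz_a : a != 0.
  apply: contraTneq (GL_unit A) => a0.
  by rewrite A_a a0 raddf0 unitr0.
apply/vspaceP=> w; rewrite -[w](scalerKV nz_a) -[in LHS]mul_mx_scalar -A_a.
rewrite mem_vsact; apply/idP/idP => [wU|]; first exact: memvZ.
by move/(memvZ a^-1); rewrite scalerK.
Qed.

Section BlockVectors.

Variables (F : fieldType) (K : fieldExtType F) (omega : K) (d : nat).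
Variables (p : {poly F}) (M : 'M[F]_d.+1).
Hypothesis p_min : map_poly (in_alg K) p = minPoly 1 omega.
Hypothesis dimK : \dim {:K} = d.+1.
Hypothesis deg_omega : adjoin_degree 1 omega = d.+1.
Hypothesis M_comp : M = companion d.+1 p.

Let phiB := phiB p_min dimK deg_omega M_comp.
Let phiM := phiM p_min dimK deg_omega M_comp.
Let phi_alg := phi_alg p_min deg_omega M_comp.
Let phi_unit := phi_unit p_min dimK deg_omega M_comp.

(* Multiplying phi x by any fixed nonzero row gives an F-linear bijection from
   K to F^d.+1 that turns multiplication by y into the action of phi y; the
   choice of the row, here the first standard basis vector, is immaterial. *)
Definition unfold (x : K) : 'rV[F]_d.+1 := delta_mx 0 0 *m phi omega M x.

Lemma unfold_is_zmod_morphism : zmod_morphism unfold.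
Proof. by move=> x y; rewrite /unfold phiB mulmxBr. Qed.

HB.instance Definition _ :=
  GRing.isZmodMorphism.Build K 'rV[F]_d.+1 unfold unfold_is_zmod_morphism.

Lemma unfoldM x y : unfold (x * y) = unfold x *m phi omega M y.
Proof. by rewrite /unfold phiM mulmxA. Qed.

Lemma unfold_eq0 x : (unfold x == 0) = (x == 0).
Proof.
apply/eqP/eqP=> [x0|->]; last exact: raddf0.
apply/eqP/contraT=> /phi_unit ux.
have /matrixP/(_ 0 0)/eqP : delta_mx 0 0 = 0 :> 'rV[F]_d.+1.
  by rewrite -[LHS](mulmxK ux) [_ *m phi _ _ _]x0 mul0mx.
by rewrite !mxE eqxx oner_eq0.
Qed.

Lemma unfoldZ a x : unfold (a *: x) = a *: unfold x.
Proof. by rewrite -mulr_algr unfoldM phi_alg mul_mx_scalar. Qed.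

(** An injective F-linear map between spaces of equal dimension is onto; [W] is its matrix in the
    basis of powers of [omega]. *)
Lemma unfold_surj w : exists x, w = unfold x.
Proof.
pose W := \matrix_(i < d.+1) unfold (omega ^+ i).
have cW c : c *m W = unfold (\sum_i c 0 i *: omega ^+ i).
  rewrite raddf_sum mulmx_sum_row; apply: eq_bigr => i _.
  by rewrite rowK /= unfoldZ.
have uW : W \in unitmx.
  rewrite -row_free_unit; apply: inj_row_free => c; rewrite cW => /eqP.
  rewrite unfold_eq0 => /eqP c0; apply/rowP=> i; rewrite mxE.
  move/freeP: (free_powers deg_omega) => /(_ (c 0)) -> //.
  rewrite -[RHS]c0; apply: eq_bigr => j _.
  by rewrite -tnth_nth tnth_mktuple.
by exists (\sum_i (w *m invmx W) 0 i *: omega ^+ i); rewrite -cW mulmxKV.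
Qed.

Definition unfold_row b (v : 'rV[K]_b) : 'rV[F]_(\sum_(j < b) d.+1) :=
  \mxrow_(j < b) unfold (v 0 j).

Lemma unfold_rowB b : {morph @unfold_row b : u v / u - v}.
Proof.
move=> u v; rewrite /unfold_row -mxrowB; apply: eq_mxrow => j.
by rewrite !mxE raddfB.
Qed.

Lemma unfold_row_inj b : injective (@unfold_row b).
Proof.
move=> u v; rewrite /unfold_row => /eq_mxrowP uv; apply/rowP=> j; apply/eqP.
by rewrite -subr_eq0 -unfold_eq0 raddfB subr_eq0; apply/eqP/uv.
Qed.

Lemma unfold_row_surj b w : exists v, w = @unfold_row b v.
Proof.
have /fin_all_exists[v def_v] (j : 'I_b) := unfold_surj (submxrow w j).
exists (\row_j v j); rewrite -[w]submxrowK; apply: eq_mxrow => j.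
by rewrite mxE def_v.
Qed.

Lemma unfold_row_mul a b (v : 'rV[K]_a) (A : 'M[K]_(a, b)) :
  unfold_row (v *m A) = unfold_row v *m phimx omega M A.
Proof.
rewrite /unfold_row /phimx mul_mxrow_mxblock; apply: eq_mxrow => j.
by rewrite mxE raddf_sum; apply: eq_bigr => i _; rewrite /= unfoldM.
Qed.

Variables (n s : nat) (hn : n = (d.+1 * s)%N).

(** The bijection rho of the overview; the cast only replaces the sum of block sizes by [n]. *)
Definition row_reduction (v : 'rV[K]_s) : 'rV[F]_n :=
  castmx (erefl, blocks_size hn) (unfold_row v).
Local Notation rho := row_reduction.

Lemma row_reductionB : {morph rho : u v / u - v}.
Proof.
(* Eliminating the size equation turns the cast into the identity. *)
rewrite /rho; case: n / (blocks_size hn) => u v.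
by rewrite !castmx_id unfold_rowB.
Qed.

Lemma row_reduction_inj : injective rho.
Proof.
rewrite /rho; case: n / (blocks_size hn) => u v.
by rewrite !castmx_id => /unfold_row_inj.
Qed.

Lemma row_reduction_surj w : exists v, w = rho v.
Proof.
rewrite /rho; case: n / (blocks_size hn) w => w.
by have [v ->] := unfold_row_surj w; exists v; rewrite castmx_id.
Qed.

Lemma row_reduction_mul v B : rho (v *m B) = rho v *m psi hn omega M B.
Proof.
rewrite /rho /psi; case: n / (blocks_size hn).
by rewrite !castmx_id unfold_row_mul.
Qed.

Lemma row_reduction_alg a v : rho (a%:A *: v) = a *: rho v.
Proof.
have aZ : unfold_row (a%:A *: v) = a *: unfold_row v.
  rewrite -[RHS]mul_scalar_mx /unfold_row mul_mxrow; apply: eq_mxrow => j.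
  by rewrite mul_scalar_mx -unfoldZ mxE mulr_algl.
rewrite /rho aZ; case: n / (blocks_size hn).
by rewrite !castmx_id.
Qed.

(** Since rho is bijective, this describes [varphi] as the image under rho, free of the chosen basis
    matrix. Every coefficient row over F unfolds from a row over K, so F-combinations of the block
    rows are images of K-combinations. *)
Lemma mem_varphi v (U : {vspace 'rV[K]_s}) :
  (rho v \in varphi hn omega M U) = (v \in U).
Proof.
have rho_mul (x : 'rV_(\dim U)) : rho (x *m vsmx U) =
    unfold_row x *m castmx (erefl, blocks_size hn) (phimx omega M (vsmx U)).
  rewrite /rho; case: n / (blocks_size hn).
  by rewrite !castmx_id unfold_row_mul.
rewrite -[in RHS](rowsp_vsmx U).
apply/mem_rowspP/mem_rowspP=> [[c]|[x ->]]; last first.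
  by exists (unfold_row x); rewrite rho_mul.
have [x ->] := unfold_row_surj c; rewrite -rho_mul => /row_reduction_inj ->.
by exists x.
Qed.

Lemma varphi_cap0 U W : (U :&: W = 0)%VS ->
  (varphi hn omega M U :&: varphi hn omega M W = 0)%VS.
Proof.
move=> cap0; apply/eqP; rewrite -subv0; apply/subvP=> w; rewrite memv_cap.
have [v ->] := row_reduction_surj w; rewrite !mem_varphi -memv_cap cap0 !memv0.
by move=> /eqP->; rewrite -(subrr 0) row_reductionB subrr.
Qed.

Lemma varphi_addf U W : (U + W = fullv)%VS ->
  (varphi hn omega M U + varphi hn omega M W = fullv)%VS.
Proof.
move=> addf; apply/vspaceP=> w; rewrite memvf.
have [v ->] := row_reduction_surj w.
have /memv_addP[u uU [x xW ->]] : v \in (U + W)%VS by rewrite addf memvf.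
by rewrite -[x]opprK row_reductionB memv_add ?memvN ?mem_varphi ?memvN.
Qed.

End BlockVectors.
(** * Subgroups of the Singer group and their stabilisers *)

Lemma dim_rV (R : fieldType) n : \dim {:'rV[R]_n} = n.
Proof. by rewrite dimvf /dim /= mul1n. Qed.

Section InvariantSubspaces.

Variables (K : fieldType) (s : nat) (B : 'M[K]_s) (U : {vspace 'rV[K]_s}).
Hypothesis BU : forall v, v \in U -> v *m B \in U.

(** A vector spanning the line is an eigenvector. *)
Lemma line_eigenvalue : \dim U = 1%N -> exists c, B - c%:M \notin unitmx.
Proof.
move=> dimU; have nz_u : vpick U != 0 by rewrite vpick0 -dimv_eq0 dimU.
have defU : <[vpick U]>%VS = U.
  by apply/eqP; rewrite eqEdim -memvE memv_pick dim_vline nz_u dimU.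
have : vpick U *m B \in <[vpick U]>%VS by rewrite defU BU ?memv_pick.
case/vlineP=> c uB.
exists c; apply: contra nz_u => uBc; apply/eqP.
rewrite -[vpick U](mulmxK uBc) mulmxBr uB mul_mx_scalar subrr.
by rewrite mul0mx.
Qed.

(* B induces a scalar c on the quotient by the hyperplane U, so the image of
   B - c lies in U. *)
Lemma hyperplane_eigenvalue : \dim U = s.-1 -> (0 < s)%N ->
  exists c, B - c%:M \notin unitmx.
Proof.
move=> dimU s_gt0.
have /subvPn[w _ wU] : ~~ (fullv <= U)%VS.
  apply: contraL s_gt0 => /dimvS; rewrite dim_rV dimU.
  by case: (s) => // s'; rewrite ltnn.
have full_wU : (U + <[w]>)%VS = fullv.
  apply/eqP; rewrite eqEdim subvf dim_rV.
  have capUw : (U :&: <[w]>)%VS = 0%VS.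
    apply/eqP; rewrite -subv0; apply/subvP=> v; rewrite memv_cap.
    case/andP=> vU /vlineP[a def_v]; rewrite memv0 def_v.
    have [->|nz_a] := eqVneq a 0; first by rewrite scale0r.
    by case/negP: wU; rewrite -[w](scalerK nz_a) memvZ // -def_v.
  rewrite dimv_disjoint_sum // dim_vline dimU.
  have -> : w != 0 by apply: contraNneq wU => ->; rewrite mem0v.
  by rewrite /= addn1 prednK ?leqnn.
have : w *m B \in (U + <[w]>)%VS by rewrite full_wU memvf.
case/memv_addP=> u uU [_ /vlineP[c ->] wB]; exists c.
have BcU v : v *m (B - c%:M) \in U.
  have : v \in (U + <[w]>)%VS by rewrite full_wU memvf.
  case/memv_addP=> u' u'U [_ /vlineP[a ->] ->].
  rewrite mulmxDl -scalemxAl !mulmxBr wB !mul_mx_scalar addrK.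
  by rewrite memvD ?memvZ // memvB ?BU // memvZ.
by apply: contra wU => uBc; rewrite -[w](mulmxKV uBc) BcU.
Qed.

End InvariantSubspaces.

Lemma lines_disjoint (K : fieldType) (V : vectType K) (U W : {vspace V}) :
  \dim U = 1%N -> \dim W = 1%N -> U != W -> (U :&: W)%VS = 0%VS.
Proof.
move=> dimU dimW; apply: contraNeq; rewrite -dimv_eq0 -lt0n => cap_gt0.
have /eqP <- : (U :&: W)%VS == U by rewrite eqEdim capvSl dimU.
by rewrite eqEdim capvSr dimW.
Qed.

Lemma hyperplanes_span (K : fieldType) (V : vectType K) (U W : {vspace V}) :
  \dim U = (\dim {:V}).-1 -> \dim W = (\dim {:V}).-1 -> U != W ->
  (U + W)%VS = fullv.
Proof.
move=> dimU dimW neqUW; apply/eqP; rewrite eqEdim subvf.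
apply: leq_trans (leqSpred _) _; rewrite -dimU ltnNge.
apply: contra neqUW => le_sum.
have /eqP defU : U == (U + W)%VS by rewrite eqEdim addvSl.
rewrite eq_sym eqEdim dimW -dimU leqnn andbT.
by rewrite defU addvSr.
Qed.

(** In a cyclic group, inclusion of subgroups is divisibility of orders, so the elements of order
    dividing [n] form the subgroup [<[h]>] of order [e]. *)
Lemma card_Ldiv_cyclic (gT : finGroupType) (G : {group gT}) n :
  cyclic G -> #|'Ldiv_n(G)%g| = gcdn #|G| n.
Proof.
move=> cycG; have [x defG] := cyclicP cycG.
set e := gcdn #|G| n; pose h := (x ^+ (#|G| %/ e))%g.
have oh : #[h]%g = e.
  have e_G : (e %| #|G|)%N := dvdn_gcdl _ _.
  rewrite orderXdiv /order -defG ?dvdn_div // -{1}(divnK e_G) mulKn //.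
  have e_gt0 : (0 < e)%N by rewrite gcdn_gt0 cardG_gt0.
  by rewrite divn_gt0 // dvdn_leq // cardG_gt0.
have hG : <[h]>%g \subset G by rewrite defG cycleX.
rewrite -oh /order; apply: eq_card => y; apply/LdivP/idP => [[Gy yn]|yh].
  rewrite -cycle_subG -(cardSg_cyclic cycG) // ?cycle_subG //.
  by rewrite -/(order h) oh dvdn_gcd order_dvdG // order_dvdn yn eqxx.
split; first exact: (subsetP hG).
apply/eqP; rewrite -order_dvdn (dvdn_trans (order_dvdG yh)) //.
by rewrite -/(order h) oh dvdn_gcdr.
Qed.

Lemma GLvalX (R : finFieldType) n (A : {'GL_n.+1[R]}) i :
  GLval (A ^+ i)%g = (GLval A : 'M_n.+1) ^+ i.
Proof. by elim: i => // i IH; rewrite expgS exprS -IH. Qed.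

(** X^q - X is the product of the X - a over all a in F, so its roots in E come from F. *)
Lemma Frobenius_fixed (F : finFieldType) (E : fieldType)
    (f : {rmorphism F -> E}) (b : E) : b ^+ #|F| = b -> exists a, b = f a.
Proof.
move/eqP; rewrite -subr_eq0 => /eqP b_q.
have /(congr1 (fun r => (map_poly f r).[b])) := finField_genPoly F.
rewrite rmorphB /= map_polyXn map_polyX hornerD hornerN hornerXn hornerX b_q.
rewrite rmorph_prod horner_prod => /esym/eqP/prodf_eq0[a _].
rewrite rmorphB /= map_polyX map_polyC hornerD hornerN hornerX hornerC subr_eq0.
by move=> /eqP; exists a.
Qed.

Lemma card_finvect (F : finFieldType) (K : fieldExtType F) :
  #|finvect_type K| = (#|F| ^ \dim {:K})%N.
Proof.
transitivity #|{: finvect_type K}%VS|; last exact: card_vspace.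
by apply: eq_card => x; rewrite [RHS]memvf.
Qed.

Lemma expf_cardB1 (F : finFieldType) (K : fieldExtType F) (c : K) :
  c != 0 -> c ^+ (#|F| ^ \dim {:K} - 1) = 1.
Proof.
move=> nz_c; apply: (mulfI nz_c); rewrite mulr1 -exprS subn1 prednK; last first.
  by rewrite expn_gt0 ltnW ?finNzRing_gt1.
rewrite -card_finvect; exact: (expf_card (c : finvect_type K)).
Qed.

Section SingerSubgroup.

Variables (F : finFieldType) (K : fieldExtType F) (E : fieldExtType K).
Variables (N d e : nat) (omega : K) (alpha : E).
Variables (p : {poly F}) (M : 'M[F]_d.+1) (r : {poly K}) (Ms : 'M[K]_e.+1).
Hypothesis p_min : map_poly (in_alg K) p = minPoly 1 omega.
Hypothesis dimK : \dim {:K} = d.+1.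
Hypothesis deg_omega : adjoin_degree 1 omega = d.+1.
Hypothesis M_comp : M = companion d.+1 p.
Hypothesis r_min : map_poly (in_alg E) r = minPoly 1 alpha.
Hypothesis deg_alpha : adjoin_degree 1 alpha = e.+1.
Hypothesis Ms_comp : Ms = companion e.+1 r.
Hypothesis hn : N.+1 = (d.+1 * e.+1)%N.
Variables (g : {'GL_N.+1[F]}) (T : {group {'GL_N.+1[F]}}).
Hypothesis g_psi : GLval g = psi hn omega M Ms.
Hypothesis T_g : T \subset <[g]>%g.

Local Notation rho := (row_reduction omega M hn).
Let rho_surj := row_reduction_surj p_min dimK deg_omega M_comp hn.
Let rho_inj := row_reduction_inj p_min dimK deg_omega M_comp (hn := hn).
Let mem_varphi := mem_varphi p_min dimK deg_omega M_comp hn.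
Let rho_mul := row_reduction_mul p_min dimK deg_omega M_comp hn.
Let rho_alg := row_reduction_alg p_min dimK deg_omega M_comp hn.

(** Through rho, questions on elements of T become questions on powers of [Ms], which are linear
    over K. *)
Lemma singer_powerP A : A \in T -> exists i,
  forall v, rho (v *m Ms ^+ i) = rho v *m (GLval A : 'M_N.+1).
Proof.
move=> /(subsetP T_g)/cycleP[i ->]; exists i => v; rewrite GLvalX.
elim: i v => [|i IH] v; first by rewrite !expr0 !mulmx1.
by rewrite !exprSr -!mulmxE !mulmxA -IH g_psi rho_mul.
Qed.

Lemma singer_powerX (A : {'GL_N.+1[F]}) i :
  (forall v, rho (v *m Ms ^+ i) = rho v *m (GLval A : 'M_N.+1)) ->
  forall j v, rho (v *m Ms ^+ (i * j)) = rho v *m (GLval (A ^+ j)%g : 'M_N.+1).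
Proof.
move=> AB j v; rewrite GLvalX exprM; elim: j v => [|j IH] v.
  by rewrite !expr0 !mulmx1.
by rewrite !exprSr -!mulmxE !mulmxA AB IH.
Qed.

Lemma rho_eq1 (B : 'M[K]_e.+1) (A : {'GL_N.+1[F]}) :
  (forall v, rho (v *m B) = rho v *m (GLval A : 'M_N.+1)) ->
  B = 1 <-> A = 1%g.
Proof.
move=> AB; split=> [B1|A1].
  apply: val_inj; change ((GLval A : 'M_N.+1) = 1%:M); apply/row_matrixP=> i.
  have [v v_i] := rho_surj (delta_mx 0 i).
  by rewrite !rowE v_i -AB B1 !mulmx1.
apply/row_matrixP=> i; rewrite !rowE.
by apply: rho_inj; rewrite AB A1 GL_1E !mulmx1.
Qed.

Lemma singer_unit (B : 'M[K]_e.+1) (A : {'GL_N.+1[F]}) :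
  (forall v, rho (v *m B) = rho v *m (GLval A : 'M_N.+1)) -> B \in unitmx.
Proof.
move=> AB; rewrite -row_free_unit; apply: inj_row_free => v vB; apply: rho_inj.
apply: (can_inj (mulmxK (GL_unit A : (GLval A : 'M_N.+1) \in unitmx))).
by rewrite -!AB vB mul0mx.
Qed.

Lemma Ms_sub_scalar i c : Ms ^+ i - c%:M = horner_mx Ms ('X^i - c%:P).
Proof. by rewrite rmorphB /= horner_mx_C rmorphXn /= horner_mx_X. Qed.

Lemma root_alpha i c :
  root (map_poly (in_alg E) ('X^i - c%:P)) alpha = (alpha ^+ i == c%:A).
Proof.
rewrite rmorphB /= map_polyXn map_polyC rootE hornerD hornerN hornerXn.
by rewrite hornerC subr_eq0.
Qed.

(** [Ms] behaves like [alpha]: a polynomial vanishing at [alpha] vanishes at [Ms], and any other is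
    invertible at [Ms]. *)
Lemma Ms_eq_scalar i c : (Ms ^+ i == c%:M) = (alpha ^+ i == c%:A).
Proof.
rewrite -subr_eq0 Ms_sub_scalar -root_alpha.
have [rt|nrt] := boolP (root _ _).
  by rewrite (horner_companion_root r_min deg_alpha Ms_comp rt) eqxx.
have u := horner_companion_unit r_min deg_alpha Ms_comp nrt.
by apply/eqP=> h0; move: u; rewrite h0 unitmxE det0 unitr0.
Qed.

(** K[[Ms]] is a field, so its only singular element is 0: one eigenvalue in K makes a power of [Ms]
    scalar. *)
Lemma Ms_sub_scalar_unit i c :
  (Ms ^+ i - c%:M \notin unitmx) = (Ms ^+ i == c%:M).
Proof.
apply/idP/eqP=> [|->]; last by rewrite subrr unitmxE det0 unitr0.
apply: contraNeq; rewrite Ms_eq_scalar Ms_sub_scalar -root_alpha.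
exact: (horner_companion_unit r_min deg_alpha Ms_comp).
Qed.

Lemma singer_exponent m A : alpha ^+ m = 1 -> A \in T -> (A ^+ m = 1)%g.
Proof.
move=> alpha1 /singer_powerP[i /singer_powerX AB].
apply/(rho_eq1 (AB m)); rewrite mulnC exprM.
suff /eqP -> : Ms ^+ m == 1%:M by rewrite expr1n.
by rewrite Ms_eq_scalar alpha1 scale1r.
Qed.

(** The corresponding power of [alpha] is fixed by the q-Frobenius, hence lies in F, and the power
    of [Ms] is the same scalar. *)
Lemma singer_scalar A : A \in T -> (A ^+ (#|F| - 1) = 1)%g ->
  exists a, GLval A = a%:M.
Proof.
case/singer_powerP=> i AB A1.
have /(rho_eq1 (singer_powerX AB _))/eqP := A1.
rewrite Ms_eq_scalar scale1r exprM => /eqP b1.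
have : (alpha ^+ i) ^+ #|F| = alpha ^+ i.
  rewrite -[X in _ ^+ X](@subnK 1) ?(ltnW (finNzRing_gt1 F)) //.
  by rewrite exprD b1 mul1r expr1.
case/(@Frobenius_fixed _ _ (in_alg E \o in_alg K)) => a /= /eqP.
rewrite -Ms_eq_scalar => /eqP BE; exists a.
apply/row_matrixP=> j; rewrite !rowE.
have [v v_j] := rho_surj (delta_mx 0 j).
by rewrite v_j -AB BE !mul_mx_scalar rho_alg.
Qed.

(** T acts through K-linear automorphisms, so it preserves both S and H; [W] is the image of [U]
    under a power of [Ms]. *)
Lemma vsact_varphi A U : A \in T -> exists2 W,
  vsact (varphi hn omega M U) A = varphi hn omega M W & \dim W = \dim U.
Proof.
case/singer_powerP=> i AB.
have uB := singer_unit AB.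
pose f := linfun (mulmxr (Ms ^+ i)) : 'End('rV[K]_e.+1).
have fE v : f v = v *m Ms ^+ i by rewrite lfunE.
have kf : lker f == 0%VS.
  by apply/lker0P=> u v; rewrite !fE => /(can_inj (mulmxK uB)).
exists (f @: U)%VS; last by rewrite limg_dim_eq // (eqP kf) capv0.
apply/vspaceP=> w; have [v ->] := rho_surj w.
rewrite -[v](mulmxKV uB) [in LHS]AB mem_vsact !mem_varphi -fE.
apply/idP/memv_imgP => [vU|[u uU]]; first by exists (v *m invmx (Ms ^+ i)).
by move/(lker0P kf) ->.
Qed.

(* U is invariant under a power B of Ms, so B has an eigenvalue in K and is
   therefore scalar, K[Ms] being a field. *)
Lemma vsact_fixed A U : A \in T -> (\dim U = 1%N \/ \dim U = e) ->
  vsact (varphi hn omega M U) A = varphi hn omega M U ->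
  (A ^+ (#|F| ^ d.+1 - 1) = 1)%g.
Proof.
move=> TA dimU fixU; have [i AB] := singer_powerP TA.
have BU v : v \in U -> v *m Ms ^+ i \in U.
  by rewrite -(mem_varphi v) -(mem_vsact _ A) fixU -AB mem_varphi.
have [c] : exists c, Ms ^+ i - c%:M \notin unitmx.
  case: dimU => dimU; first exact: (line_eigenvalue BU).
  exact: (hyperplane_eigenvalue BU).
rewrite Ms_sub_scalar_unit => /eqP Bc; apply/(rho_eq1 (singer_powerX AB _))/eqP.
have /eqP := Bc; rewrite !Ms_eq_scalar exprM => /eqP->.
have nz_c : c != 0.
  by apply/eqP=> c0; move: (singer_unit AB); rewrite Bc c0 raddf0 unitr0.
by rewrite scale1r -in_algE -rmorphXn -dimK expf_cardB1 // rmorph1.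
Qed.

End SingerSubgroup.
(** * Flag distances and partial spreads *)

Section FlagDistance.

Variables (R : fieldType) (n : nat).
Implicit Types U W : {vspace 'rV[R]_n}.

(** The general upper bound 2 min(d, n - d) for the distance of two d-dimensional subspaces. *)
Definition max_subspace_dist (d : nat) : nat :=
  (2 * (if 2 * d <= n then d else n - d))%N.

Lemma subspace_distE U W d : \dim U = d -> \dim W = d ->
  subspace_dist U W = (2 * d - 2 * \dim (U :&: W))%N.
Proof.
move=> dimU dimW; move: (dimv_sum_cap U W).
by rewrite /subspace_dist dimU dimW; lia.
Qed.

Lemma subspace_dist_le U W d : \dim U = d -> \dim W = d ->
  (subspace_dist U W <= max_subspace_dist d)%N.
Proof.
move=> dimU dimW; move: (dimv_sum_cap U W) (dimvS (subvf (U + W)%VS)).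
rewrite (subspace_distE dimU dimW) dim_rV dimU dimW /max_subspace_dist.
by case: ifP; lia.
Qed.

Lemma subspace_dist_max_cap0 U W d : \dim U = d -> \dim W = d ->
  (2 * d <= n)%N ->
  (subspace_dist U W == max_subspace_dist d) = (U :&: W == 0)%VS.
Proof.
move=> dimU dimW d_small; rewrite (subspace_distE dimU dimW) /max_subspace_dist.
have := dimvS (capvSl U W); rewrite d_small -dimv_eq0 dimU => ?.
by apply/eqP/eqP; lia.
Qed.

Lemma subspace_dist_max_addf U W d : \dim U = d -> \dim W = d ->
  (n <= 2 * d)%N -> (U + W)%VS = fullv ->
  subspace_dist U W = max_subspace_dist d.
Proof.
move=> dimU dimW d_large fullUW; move: (dimv_sum_cap U W).
rewrite (subspace_distE dimU dimW) fullUW dim_rV dimU dimW /max_subspace_dist.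
by case: ifP; lia.
Qed.

Variables (ty : seq nat) (k : nat).
(** The value required by [optimum_distance], rewritten below as a sum of componentwise bounds. *)
Definition optimum_flag_dist : nat :=
  (2 * (\sum_(d <- ty | 2 * d <= n) d + \sum_(d <- ty | n < 2 * d) (n - d)))%N.

Lemma optimum_flag_distE : optimum_flag_dist =
  \sum_(0 <= i < size ty) max_subspace_dist (nth 0%N ty i).
Proof.
rewrite /optimum_flag_dist.
rewrite [X in (X + _)%N]big_mkcond [X in (_ + X)%N]big_mkcond.
rewrite -big_split big_distrr (big_nth 0%N); apply: eq_bigr => i _ /=.
by rewrite /max_subspace_dist; case: leqP; lia.
Qed.

Hypotheses (k_small : (2 * k <= n)%N).
Hypothesis ty_sorted : sorted ltn ty.
Hypotheses (ty_k : k \in ty) (ty_nk : (n - k)%N \in ty).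
Hypothesis ty_sub : forall d, d \in ty -> (d <= k)%N || (n - k <= d)%N.

Implicit Types f g : seq {vspace 'rV[R]_n}.

Lemma size_flag f : is_flag ty f -> size f = size ty.
Proof. by case/andP=> /eqP <- _; rewrite size_map. Qed.

Lemma dim_flag_nth f i : is_flag ty f -> \dim (nth 0%VS f i) = nth 0%N ty i.
Proof.
move=> fl; have [lti|lei] := ltnP i (size f); last first.
  by rewrite !nth_default ?dimv0 // -(size_flag fl).
by case/andP: fl => /eqP <- _; rewrite (nth_map 0%VS).
Qed.

Lemma flag_nth_subv f i j : is_flag ty f -> (i <= j < size ty)%N ->
  (nth 0 f i <= nth 0 f j)%VS.
Proof.
move=> fl /andP[leij ltj]; have [_ sorted_f] := andP fl.
have tr : transitive (fun U W : {vspace 'rV[R]_n} => U <= W)%VS.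
  by move=> W U V; apply: subv_trans.
apply: (sorted_leq_nth tr (@subvv _ _)) => //; rewrite !inE (size_flag fl) //.
exact: leq_ltn_trans ltj.
Qed.

Lemma dim_flag_member f d : is_flag ty f -> d \in ty ->
  \dim (flag_member ty f d) = d.
Proof. by move=> fl ty_d; rewrite dim_flag_nth // nth_index. Qed.

Lemma flag_dist_sum f g : is_flag ty f -> is_flag ty g -> flag_dist f g =
  \sum_(0 <= i < size ty) subspace_dist (nth 0%VS f i) (nth 0%VS g i).
Proof.
move=> ff fg; have sz_fg : size f = size g by rewrite !size_flag.
rewrite /flag_dist (big_nth (0, 0)%VS) size_zip -sz_fg minnn (size_flag ff).
by apply: eq_bigr => i _; rewrite nth_zip.
Qed.

(** Members of dimension at most k lie inside the k-dimensional ones and so meet trivially; the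
    others contain the (n - k)-dimensional ones and so span. Every component thus attains its
    bound. *)
Lemma flag_dist_optimum f g : is_flag ty f -> is_flag ty g ->
  (flag_member ty f k :&: flag_member ty g k = 0)%VS ->
  (flag_member ty f (n - k) + flag_member ty g (n - k) = fullv)%VS ->
  flag_dist f g = optimum_flag_dist.
Proof.
move=> ff fg cap0 addf; rewrite flag_dist_sum // optimum_flag_distE.
have small_le (d : nat) : (d <= k -> 2 * d <= n)%N by lia.
have large_ge (d : nat) : (n - k <= d -> n <= 2 * d)%N by lia.
apply: eq_big_nat => i /andP[_ lti].
have := ty_sub (mem_nth 0%N lti) => /orP[le_k|ge_nk].
  apply/eqP; rewrite subspace_dist_max_cap0 ?dim_flag_nth ?small_le //.
  rewrite -subv0 -[X in (_ <= X)%VS]cap0 /flag_member; set j := index k ty.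
  (* As [ty] is strictly increasing, a dimension at most k stands no later than k. *)
  have leij : (i <= j < size ty)%N.
    rewrite index_mem ty_k andbT leqNgt; apply: contraL le_k => ltji.
    rewrite -ltnNge -[X in (X < _)%N](nth_index 0%N ty_k).
    by apply: (sorted_ltn_nth ltn_trans) => //; rewrite inE // index_mem.
  by rewrite capvS ?flag_nth_subv.
apply: subspace_dist_max_addf; rewrite ?dim_flag_nth ?large_ge //.
apply/eqP; rewrite eqEsubv subvf -addf /flag_member.
set j := index (n - k)%N ty.
have leij : (j <= i < size ty)%N.
  rewrite lti andbT leqNgt; apply: contraL ge_nk => ltij.
  rewrite -ltnNge -[X in (_ < X)%N](nth_index 0%N ty_nk).
  by apply: (sorted_ltn_nth ltn_trans) => //; rewrite inE // index_mem.
by rewrite addvS ?flag_nth_subv.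
Qed.

(** A sum that reaches the total of its componentwise bounds attains each of them, in particular the
    one at k. *)
Lemma optimum_flag_dist_cap0 f g : is_flag ty f -> is_flag ty g ->
  (optimum_flag_dist <= flag_dist f g)%N ->
  (flag_member ty f k :&: flag_member ty g k = 0)%VS.
Proof.
move=> ff fg; rewrite optimum_flag_distE flag_dist_sum // => le_sum; apply/eqP.
rewrite -(subspace_dist_max_cap0 (d := k)) ?dim_flag_member //.
have lt_k : (index k ty < size ty)%N by rewrite index_mem.
have le_i (i : nat) : (subspace_dist (nth 0%VS f i) (nth 0%VS g i)
    <= max_subspace_dist (nth 0%N ty i))%N.
  by apply: subspace_dist_le; rewrite dim_flag_nth.
have := le_i (index k ty); rewrite leq_eqVlt nth_index // => /orP[//|lt_i].
suff : (flag_dist f g < optimum_flag_dist)%N.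
  by rewrite optimum_flag_distE flag_dist_sum // ltnNge le_sum.
rewrite optimum_flag_distE flag_dist_sum //.
have split_k (G : nat -> nat) : (\sum_(0 <= i < size ty) G i =
    \sum_(0 <= i < index k ty) G i + (G (index k ty)
      + \sum_((index k ty).+1 <= i < size ty) G i))%N.
  by rewrite (big_cat_nat (n := index k ty)) ?(ltnW lt_k) //= (big_ltn lt_k).
rewrite !split_k nth_index // -addnS -addSn.
by rewrite leq_add ?leq_add //; apply: leq_sum.
Qed.

Local Open Scope fset_scope.

Lemma min_flag_dist_le (C : {fset seq {vspace 'rV[R]_n}}) f g :
  f \in C -> g \in C -> f != g -> (min_flag_dist C <= flag_dist f g)%N.
Proof.
move=> Cf Cg neq_fg; rewrite /min_flag_dist; set ds := map _ _.
have : flag_dist f g \in ds.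
  apply/mapP; exists (f, g) => //; rewrite mem_filter /= neq_fg.
  by apply/allpairsP; exists (f, g).
move: (head _ _) => z; elim: ds => // d ds IH; rewrite inE big_cons.
by case/predU1P=> [->|/IH]; rewrite geq_min ?leqnn // => ->; rewrite orbT.
Qed.

Lemma min_flag_dist_const (C : {fset seq {vspace 'rV[R]_n}}) D f g :
  f \in C -> g \in C -> f != g ->
  {in C &, forall f g, f != g -> flag_dist f g = D} ->
  min_flag_dist C = D.
Proof.
move=> Cf Cg neq_fg distC.
rewrite /min_flag_dist; set ds := map _ _.
have ds_D : all (pred1 D) ds.
  apply/allP=> z /mapP[[f' g']]; rewrite mem_filter /= => /andP[neq].
  case/allpairsP=> [[h h'] /= [Ch Ch' [eq_h eq_h']]] ->.
  by rewrite distC ?eq_h ?eq_h' // -eq_h -eq_h'.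
(* The pair [f], [g] makes [ds] nonempty, so the minimum starts from a true distance and not from
   the default 0. *)
have : flag_dist f g \in ds.
  apply/mapP; exists (f, g) => //; rewrite mem_filter /= neq_fg.
  by apply/allpairsP; exists (f, g).
case: ds ds_D => // d ds /= /andP[/eqP-> dsD] _.
rewrite big_cons; have -> : \big[minn/D]_(e <- ds) e = D; last exact: minnn.
elim: ds dsD => [_|e ds IH] /=; first exact: big_nil.
by case/andP=> /eqP-> /IH; rewrite big_cons => ->; rewrite minnn.
Qed.

Lemma optimum_distance_partial_spread (C : {fset seq {vspace 'rV[R]_n}}) f g :
  is_flag_code ty C -> f \in C -> g \in C -> f != g ->
  {in C &, forall f g, f != g ->
    (flag_member ty f k :&: flag_member ty g k = 0)%VS /\
    (flag_member ty f (n - k) + flag_member ty g (n - k) = fullv)%VS} ->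
  optimum_distance ty C.
Proof.
move=> flC Cf Cg neq_fg distC; split=> //.
apply: (min_flag_dist_const Cf Cg neq_fg) => f' g' Cf' Cg' neq.
have [cap0 addf] := distC f' g' Cf' Cg' neq.
by apply: flag_dist_optimum; rewrite ?flC.
Qed.

Lemma optimum_distance_cap0 (C : {fset seq {vspace 'rV[R]_n}}) :
  optimum_distance ty C -> {in C &, forall f g, f != g ->
    (flag_member ty f k :&: flag_member ty g k = 0)%VS}.
Proof.
move=> [flC distC] f g Cf Cg neq_fg.
apply: optimum_flag_dist_cap0; rewrite ?flC //.
by rewrite /optimum_flag_dist -distC min_flag_dist_le.
Qed.

End FlagDistance.
(** The sets of nonzero vectors of the [h x] are pairwise disjoint, have q^k - 1 elements each, and
    lie among q^n - 1 vectors. *)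
Lemma partial_spread_card (F : finFieldType) (n k : nat) (X : choiceType)
    (C : {fset X}) (h : X -> {vspace 'rV[F]_n}) : (0 < k)%N ->
  {in C, forall x, \dim (h x) = k} ->
  {in C &, forall x y, x != y -> (h x :&: h y = 0)%VS} ->
  (#|` C|%fset <= (#|F| ^ n - 1) %/ (#|F| ^ k - 1))%N.
Proof.
move=> k_gt0 dim_h cap_h.
have F_gt1 := finNzRing_gt1 F.
rewrite leq_divRL ?subn_gt0 -?(expn0 #|F|) ?ltn_exp2l //.
pose A (x : C) := [set v in h (val x) | v != 0].
have disjA x y : x != y -> [disjoint A x & A y].
  move=> neq; apply/pred0P=> v; rewrite /= !inE; apply/negP.
  case/andP=> /andP[vx nz_v] /andP[vy _]; case/negP: nz_v.
  by rewrite -memv0 -(cap_h _ _ (valP x) (valP y) neq) memv_cap vx.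
have cardA x : #|A x| = (#|F| ^ k - 1)%N.
  have <- : #|[set v in h (val x)]| = (#|F| ^ k)%N.
    by rewrite cardsE -(dim_h _ (valP x)); apply: card_vspace.
  have -> : A x = [set v in h (val x)] :\ 0.
    by apply/setP=> v; rewrite !inE andbC.
  by rewrite [in RHS](cardsD1 0) inE mem0v addnC addnK.
have := partition_disjoint_bigcup addn (fun=> 1%N) disjA.
rewrite sum1_card (eq_bigr (fun=> #|F| ^ k - 1)%N); last first.
  by move=> x _; rewrite sum1_card cardA.
rewrite sum_nat_const -cardfE => <-.
have -> : (#|F| ^ n - 1)%N = #|[set~ (0 : 'rV[F]_n)]|.
  by rewrite cardsC1 card_mx mul1n subn1.
apply/subset_leq_card/bigcupsP => x _; apply/subsetP=> v.
by rewrite !inE => /andP[].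
Qed.

(** * Orbit codes *)

Section OrbitCode.

Variables (F : finFieldType) (N : nat).
Implicit Types (U : {vspace 'rV[F]_N.+1}) (A : {'GL_N.+1[F]}).

Lemma GL_row_surj A (w : 'rV_N.+1) : exists v, w = v *m (GLval A : 'M_N.+1).
Proof.
by exists (w *m invmx (GLval A : 'M_N.+1)); rewrite mulmxKV ?(GL_unit A).
Qed.

Lemma vsactM U A A' : vsact (vsact U A) A' = vsact U (A * A')%g.
Proof.
apply/vspaceP=> w; have [v ->] := GL_row_surj (A * A')%g w.
by rewrite [in RHS]mem_vsact GL_MxE mulmxA !mem_vsact.
Qed.

Lemma vsact1 U : vsact U 1%g = U.
Proof. apply/vspaceP=> w; rewrite -[in LHS](mulmx1 w).
exact: (mem_vsact U 1%g w). Qed.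

Lemma vsactK U A A' : (vsact U A == vsact U A') = (vsact U (A * A'^-1)%g == U).
Proof.
apply/eqP/eqP=> [eqA|fixA]; first by rewrite -vsactM eqA vsactM mulgV vsact1.
by rewrite -[in RHS]fixA vsactM mulgKV.
Qed.

Lemma vsactS U W A : (vsact U A <= vsact W A)%VS = (U <= W)%VS.
Proof.
apply/subvP/subvP => UW w.
  by rewrite -(mem_vsact U A) -(mem_vsact W A); apply: UW.
by have [v ->] := GL_row_surj A w; rewrite !mem_vsact; apply: UW.
Qed.

Lemma dim_vsact U A : \dim (vsact U A) = \dim U.
Proof.
have dim_le W B : (\dim (vsact W B) <= \dim W)%N.
  apply: leq_trans (dim_span _) _.
  by rewrite size_map size_enum_ord.
(* The reverse inequality is [dim_le] for the inverse of [A], applied to [vsact U A]. *)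
by apply/eqP; rewrite eqn_leq dim_le -{1}[U](vsact1) -(mulgV A) -vsactM dim_le.
Qed.

Lemma flagact_is_flag ty f A : is_flag ty f -> is_flag ty (flagact f A).
Proof.
case/andP=> /eqP <- sorted_f; apply/andP; split.
  by rewrite -map_comp; apply/eqP/eq_map => U /=; rewrite dim_vsact.
by rewrite sorted_map; apply: sub_sorted sorted_f => U W /=; rewrite vsactS.
Qed.

Lemma flag_member_act ty f A d :
  is_flag ty f -> d \in ty ->
  flag_member ty (flagact f A) d = vsact (flag_member ty f d) A.
Proof.
move=> fl ty_d; rewrite /flag_member (nth_map 0%VS) // (size_flag fl).
by rewrite index_mem.
Qed.

Variables (ty : seq nat) (k m : nat) (T Z : {group {'GL_N.+1[F]}}).
Variable fl : 'I_m -> seq {vspace 'rV[F]_N.+1}.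
Hypothesis flP : forall j, is_flag ty (fl j).
Hypothesis ZT : Z \subset T.
Hypothesis Z_fix : forall A U, A \in Z -> vsact U A = U.

Lemma mem_orbP (X : choiceType) act x y :
  reflect (exists2 A, A \in T & y = act x A) (y \in @orb F N X act T x).
Proof. exact: imfsetP. Qed.

Lemma orb_vsact_eq U W A B : A \in T -> B \in T -> vsact U A = vsact W B ->
  orb (@vsact F N) T U = orb (@vsact F N) T W.
Proof.
move=> TA TB eqUW.
have defU : U = vsact W (B * A^-1)%g.
  by rewrite -vsactM -eqUW vsactM mulgV vsact1.
apply/fsetP=> V; apply/mem_orbP/mem_orbP=> -[D TD ->].
  by exists (B * A^-1 * D)%g; rewrite ?groupM ?groupV // -vsactM -defU.
exists (A * B^-1 * D)%g; first by rewrite ?groupM ?groupV.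
by rewrite defU vsactM !mulgA mulgKV mulgV mul1g.
Qed.

Definition orbit_code := (\bigcup_(j | true) orb (@flagact F N) T (fl j))%fset.

Lemma orbit_codeP f :
  reflect (exists j, exists2 A, A \in T & f = flagact (fl j) A)
          (f \in orbit_code).
Proof.
apply: (iffP idP) => [/bigfcupP[j _ /mem_orbP[A TA ->]]|[j [A TA ->]]].
  by exists j, A.
apply/bigfcupP; exists j; first by rewrite mem_index_enum.
by apply/mem_orbP; exists A.
Qed.

(** [Z] will be the group of scalars in T, so a codeword depends only on a flag index and a coset of
    [Z]. *)
Lemma flagact_coset f A B : (A * B^-1)%g \in Z -> flagact f A = flagact f B.
Proof.
by move=> ZAB; apply: eq_map => U; apply/eqP; rewrite vsactK Z_fix.
Qed.

Section OneMember.

Variable d : nat.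
Hypothesis ty_d : d \in ty.
Hypothesis orb_d : forall i j, i != j ->
  orb (@vsact F N) T (flag_member ty (fl i) d)
  != orb (@vsact F N) T (flag_member ty (fl j) d).
Hypothesis stab_d : forall j A, A \in T ->
  vsact (flag_member ty (fl j) d) A = flag_member ty (fl j) d -> A \in Z.

Lemma orbit_member_inj i j A B : A \in T -> B \in T ->
  flag_member ty (flagact (fl i) A) d = flag_member ty (flagact (fl j) B) d ->
  i = j /\ (A * B^-1)%g \in Z.
Proof.
move=> TA TB; rewrite !flag_member_act // => eqAB.
have eq_ij : i = j.
  apply/eqP/contraT=> /orb_d/eqP[]; exact: orb_vsact_eq eqAB.
subst j; split=> //; apply: (@stab_d i); first by rewrite groupM ?groupV.
by apply/eqP; rewrite -vsactK; apply/eqP.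
Qed.

(** A codeword is determined by its member of dimension [d]; this is applied for both k and n -
    k. *)
Lemma orbit_member_neq f g : f \in orbit_code -> g \in orbit_code -> f != g ->
  flag_member ty f d != flag_member ty g d.
Proof.
case/orbit_codeP=> i [A TA ->] /orbit_codeP[j [B TB ->]].
apply: contra_neq => /(orbit_member_inj TA TB)[-> ZAB].
exact: flagact_coset.
Qed.

Lemma card_orbit_code : #|` orbit_code|%fset = (m * #|T : Z|%g)%N.
Proof.
(* The code is parametrised bijectively by pairs of a flag index and a right coset of [Z] in T. *)
pose h (x : 'I_m * {set {'GL_N.+1[F]}}) := flagact (fl x.1) (repr x.2).
pose P := setX [set: 'I_m] (rcosets Z T).
have P_repr x : x \in P -> repr x.2 \in T /\ x.2 = (Z :* repr x.2)%g.
  rewrite inE => /andP[_ /rcosetsP[A TA def_x]].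
  rewrite def_x rcoset_repr; split=> //.
  by case: repr_rcosetP => B ZB; rewrite groupM // (subsetP ZT).
have -> : orbit_code = [fset h x | x in P]%fset.
  apply/fsetP=> f; apply/orbit_codeP/imfsetP=> /= [[j [A TA ->]]|[x Px ->]].
    exists (j, (Z :* A)%g); first by rewrite !inE /= mem_rcosets mulSGid.
    apply: flagact_coset; rewrite /=; case: repr_rcosetP => B ZB.
    by rewrite invMg mulgA mulgV mul1g groupV.
  by have [Tx _] := P_repr x Px; exists x.1, (repr x.2).
rewrite card_in_imfset => [|x y Px Py].
  by rewrite -cardE cardsX cardsT card_ord.
have [[Tx def_x] [Ty def_y]] := (P_repr x Px, P_repr y Py).
rewrite /h => /(congr1 (fun f => flag_member ty f d)).
case/(orbit_member_inj Tx Ty); rewrite -mem_rcoset => eq1 /rcoset_eqP eq2.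
by case: x y eq1 eq2 def_x def_y {Px Py Tx Ty} => [i X] [j Y] /= -> eq2 -> ->;
  rewrite eq2.
Qed.

End OneMember.

End OrbitCode.

(** * Arithmetic of the flag type and of the orbit count, and the theorem *)

Lemma ftype_sorted n k : (2 * k <= n)%N -> sorted ltn (ftype n k).
Proof.
(* The concatenation is only weakly increasing: k and n - k coincide when n = 2k, and [undup]
   removes the repetition. *)
move=> k_small; rewrite ltn_sorted_uniq_leq undup_uniq /=.
apply: (subseq_sorted leq_trans (undup_subseq _)).
rewrite (sorted_pairwise leq_trans) pairwise_cat.
rewrite -!(sorted_pairwise leq_trans) !iota_sorted !andbT.
by apply/allrelP=> x y; rewrite !mem_iota; lia.
Qed.

Lemma mem_ftype n k d : (d \in ftype n k) =
  (0 < d <= k)%N || (n - k <= d < n - k + k)%N.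
Proof. by rewrite mem_undup mem_cat !mem_iota add1n ltnS. Qed.

(** The division defining [m] is exact: lcm(t, Q) divides P and equals Q t / gcd(t, Q), so [m] is P
    / lcm(t, Q). *)
Lemma card_orbits_arith m t P Q : (0 < Q)%N -> (0 < t)%N ->
  (t %| P)%N -> (Q %| P)%N -> m = (P * gcdn t Q %/ (Q * t))%N ->
  (m * (t %/ gcdn t Q))%N = (P %/ Q)%N.
Proof.
move=> Q_gt0 t_gt0 tP QP ->.
have G_gt0 : (0 < gcdn t Q)%N by rewrite gcdn_gt0 t_gt0.
have /dvdnP[L ->] : (lcmn t Q %| P)%N by rewrite dvdn_lcm tP.
have def_t : t = (t %/ gcdn t Q * gcdn t Q)%N by rewrite divnK ?dvdn_gcdl.
have lcmE : lcmn t Q = (t %/ gcdn t Q * Q)%N.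
  by apply/eqP; rewrite -(eqn_pmul2r G_gt0) muln_lcm_gcd mulnAC -def_t.
rewrite -mulnA muln_lcm_gcd (mulnC Q) mulnK ?muln_gt0 ?t_gt0 //.
by rewrite lcmE mulnA mulnK.
Qed.

(* F = F_q, K = F_(q^k), E = F_(q^n), with n written N.+1. *)
Theorem theorem5p2
  (F : finFieldType) (K : fieldExtType F) (E : fieldExtType K)
  (q N k s t m : nat)
  (hq : #|F| = q) (hk : \dim {:K} = k) (hE : \dim {:E} = s)
  (hn : N.+1 = (k * s)%N) (hs : (2 <= s)%N)
  (omega : K) (homega : (q ^ k - 1)%N.-primitive_root omega)
  (pomega : {poly F}) (hpomega : map_poly (in_alg K) pomega = minPoly 1 omega)
  (alpha : E) (halpha : (q ^ N.+1 - 1)%N.-primitive_root alpha)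
  (palpha : {poly K}) (hpalpha : map_poly (in_alg E) palpha = minPoly 1 alpha)
  (Mk : 'M[F]_k) (hMk : Mk = companion k pomega)
  (Ms : 'M[K]_s) (hMs : Ms = companion s palpha)
  (g : {'GL_N.+1[F]}) (hg : GLval g = psi hn omega Mk Ms)
  (T : {group {'GL_N.+1[F]}}) (hT : T \subset <[g]>%g) (ht : #|T| = t)
  (hgcd : gcdn t (q ^ k - 1) = gcdn t (q - 1))
  (hm : (2 <= m)%N)
  (ty : seq nat) (hty : ty = ftype N.+1 k)
  (fl : 'I_m -> seq {vspace 'rV[F]_N.+1})
  (hfl : forall j, is_flag ty (fl j))
  (hS : forall j, Slines hn omega Mk (flag_member ty (fl j) k))
  (hSorb : forall i j, i != j ->
     orb (@vsact F N) T (flag_member ty (fl i) k)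
     != orb (@vsact F N) T (flag_member ty (fl j) k))
  (hH : forall j, Hhyperplanes hn omega Mk (flag_member ty (fl j) (N.+1 - k)))
  (hHorb : forall i j, i != j ->
     orb (@vsact F N) T (flag_member ty (fl i) (N.+1 - k))
     != orb (@vsact F N) T (flag_member ty (fl j) (N.+1 - k))) :
  let C := (\bigcup_(j | true) orb (@flagact F N) T (fl j))%fset in
  (optimum_distance ty C /\ #|` C|%fset = ((m * t) %/ gcdn t (q - 1))%N) /\
  (m = (((q ^ N.+1 - 1) * gcdn t (q - 1)) %/ ((q ^ k - 1) * t))%N ->
   [/\ optimum_distance ty C,
       #|` C|%fset = ((q ^ N.+1 - 1) %/ (q ^ k - 1))%N &
       forall C' : {fset seq {vspace 'rV[F]_N.+1}}, optimum_distance ty C' ->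
         (#|` C'|%fset <= (q ^ N.+1 - 1) %/ (q ^ k - 1))%N]).
Proof.
have F_gt1 := finNzRing_gt1 F.
(* From here k = d + 1 and s = e + 1, so hyperplanes over K have dimension [e]. *)
destruct k as [|d]; first by [].
destruct s as [|e]; first by [].
subst q t ty.
have k_small : (2 * d.+1 <= N.+1)%N by rewrite hn mulnC leq_mul2l.
have ty_sorted := ftype_sorted k_small.
have ty_k : d.+1 \in ftype N.+1 d.+1 by rewrite mem_ftype /= leqnn.
have ty_nk : (N.+1 - d.+1)%N \in ftype N.+1 d.+1.
  by rewrite mem_ftype; apply/orP; right; lia.
have ty_sub x : x \in ftype N.+1 d.+1 -> (x <= d.+1)%N || (N.+1 - d.+1 <= x)%N.
  by rewrite mem_ftype => /orP[/andP[_ ->]|/andP[->]] //; rewrite orbT.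
have deg_omega : adjoin_degree 1 omega = d.+1.
  rewrite -hk; apply: (adjoin_degree_primitive (enum_uniq F)).
    by move=> c; rewrite mem_enum.
  by rewrite -cardE hk.
(* K is enumerated through [finvect_type K]; the order of [alpha] then fits because (q^k)^s =
   q^n. *)
have card_K : size (enum (finvect_type K)) = (#|F| ^ d.+1)%N.
  by rewrite -cardE card_finvect hk.
have deg_alpha : adjoin_degree 1 alpha = e.+1.
  rewrite -hE.
  apply: (@adjoin_degree_primitive K E (enum (finvect_type K)) _ (enum_uniq _)).
    by move=> c; apply: etrans (mem_enum (finvect_type K) c) _.
  by rewrite card_K hE -expnM -hn.
have cycT : cyclic T := cyclicS hT (cycle_cyclic g).
(* The common stabiliser: the elements of T of order dividing q - 1 form a group because T is
   abelian. *)
pose Z := Group (group_Ldiv (#|F| - 1) (cyclic_abelian cycT)).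
have cardZ : #|Z| = gcdn #|T| (#|F| - 1) := card_Ldiv_cyclic _ cycT.
have ZT : Z \subset T by apply: subsetIl.
have Z_fix A U : A \in Z -> vsact U A = U.
  case/LdivP=> TA A1; have [a] := singer_scalar hpomega hk deg_omega hMk hpalpha
    deg_alpha hMs hg hT TA A1.
  exact: vsact_scalar.
have stab U A : A \in T -> (\dim U = 1%N \/ \dim U = e) ->
    vsact (varphi hn omega Mk U) A = varphi hn omega Mk U -> A \in Z.
  move=> TA dimU fixU; have /eqP := vsact_fixed hpomega hk deg_omega hMk hpalpha
    deg_alpha hMs hg hT TA dimU fixU.
  rewrite -order_dvdn => A_k.
  apply/LdivP; split=> //; apply/eqP; rewrite -order_dvdn.
  apply: dvdn_trans (dvdn_gcdr #|T| _).
  (* The gcd hypothesis enters here: the order of [A] divides both t and q^k - 1. *)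
  by rewrite -hgcd dvdn_gcd order_dvdG.
have stab_k j A : A \in T -> vsact (flag_member (ftype N.+1 d.+1) (fl j) d.+1) A
    = flag_member (ftype N.+1 d.+1) (fl j) d.+1 -> A \in Z.
  by move=> TA; have [U dimU ->] := hS j; apply: stab TA (or_introl dimU).
have stab_nk j A : A \in T ->
    vsact (flag_member (ftype N.+1 d.+1) (fl j) (N.+1 - d.+1)) A
    = flag_member (ftype N.+1 d.+1) (fl j) (N.+1 - d.+1) -> A \in Z.
  by move=> TA; have [U dimU ->] := hH j; apply: stab TA (or_intror dimU).
move=> C.
have flC : is_flag_code (ftype N.+1 d.+1) C.
  by move=> f /orbit_codeP[j [A TA ->]]; apply: flagact_is_flag.
have distC : {in C &, forall f f', f != f' ->
    (flag_member (ftype N.+1 d.+1) f d.+1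
      :&: flag_member (ftype N.+1 d.+1) f' d.+1 = 0)%VS /\
    (flag_member (ftype N.+1 d.+1) f (N.+1 - d.+1)
      + flag_member (ftype N.+1 d.+1) f' (N.+1 - d.+1) = fullv)%VS}.
  move=> f f' Cf Cf' neq.
  have neq_k := orbit_member_neq hfl Z_fix ty_k hSorb stab_k Cf Cf' neq.
  have neq_nk := orbit_member_neq hfl Z_fix ty_nk hHorb stab_nk Cf Cf' neq.
  have /orbit_codeP[i [A TA def_f]] := Cf.
  have /orbit_codeP[j [B TB def_f']] := Cf'.
  subst f f'; move: neq_k neq_nk; rewrite !flag_member_act //.
  (* The members of both codewords are again reductions of lines and hyperplanes over K, and these
     differ because their images differ. *)
  have act_red := vsact_varphi hpomega hk deg_omega hMk hg hT.
  have [[U dimU ->] [U' dimU' ->]] := (hS i, hS j).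
  have [[V dimV ->] [V' dimV' ->]] := (hH i, hH j).
  have [[W -> dimW] [W' -> dimW']] := (act_red A U TA, act_red B U' TB).
  have [[X -> dimX] [X' -> dimX']] := (act_red A V TA, act_red B V' TB).
  move=> neqW neqX; split.
    apply: (varphi_cap0 hpomega hk deg_omega hMk); apply: lines_disjoint.
    - by rewrite dimW.
    - by rewrite dimW'.
    by apply: contra_neq neqW => ->.
  apply: (varphi_addf hpomega hk deg_omega hMk); apply: hyperplanes_span.
  - by rewrite dimX dimV dim_rV.
  - by rewrite dimX' dimV' dim_rV.
  by apply: contra_neq neqX => ->.
have optC : optimum_distance (ftype N.+1 d.+1) C.
  have m_gt0 : (0 < m)%N by lia.
  (* Since m >= 2 there are two flags with k-dimensional members in different orbits, so the code
     has two distinct elements and its minimum distance is not the default 0. *)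
  pose i0 := Ordinal m_gt0; pose i1 := Ordinal hm.
  have C_fl i : flagact (fl i) 1%g \in C by apply/orbit_codeP; exists i, 1%g.
  apply: (optimum_distance_partial_spread k_small ty_sorted ty_k ty_nk ty_sub
    flC (C_fl i0) (C_fl i1) _ distC).
  apply/eqP=> /(congr1 (fun f => flag_member (ftype N.+1 d.+1) f d.+1)).
  by case/(orbit_member_inj hfl ty_k hSorb stab_k (group1 T) (group1 T)).
have Z_dvd : (gcdn #|T| (#|F| - 1) %| #|T|)%N := dvdn_gcdl _ _.
have cardC : #|` C|%fset = (m * (#|T| %/ gcdn #|T| (#|F| - 1)))%N.
  by rewrite (card_orbit_code hfl ZT Z_fix ty_k hSorb stab_k) -divgS // cardZ.
split; first by split=> //; rewrite cardC muln_divA.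
move=> def_m; split=> // [|C' optC']; last first.
  have [flC' _] := optC'.
  apply: (partial_spread_card
    (h := fun f => flag_member (ftype N.+1 d.+1) f d.+1)) => //.
  - by move=> f /flC' fl_f; rewrite (dim_flag_member fl_f).
  exact: (optimum_distance_cap0 k_small ty_k optC').
rewrite cardC.
(* The order of [alpha] is q^n - 1, so [g] raised to this exponent is 1. *)
have t_P : (#|T| %| #|F| ^ N.+1 - 1)%N.
  apply: dvdn_trans (cardSg hT) _; rewrite -/(order g) order_dvdn; apply/eqP.
  apply: (singer_exponent hpomega hk deg_omega hMk hpalpha deg_alpha hMs hg
    (T := <[g]>%G)) (cycle_id g) => //.
  exact: prim_expr_order.
have Q_P : (#|F| ^ d.+1 - 1 %| #|F| ^ N.+1 - 1)%N.
  by rewrite hn expnM !subn1 [X in (_ %| X)%N]predn_exp dvdn_mulr.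
(* Replacing gcd(t, q - 1) by gcd(t, q^k - 1) makes the arithmetic lemma applicable with Q = q^k -
   1. *)
rewrite -hgcd in def_m *.
apply: card_orbits_arith; rewrite ?cardG_gt0 //.
by rewrite subn_gt0 -{1}(expn0 #|F|) ltn_exp2l.
Qed.
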